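(* Let $G=(V,E,\ell)$ be a labeled DAG and $Q\in\Sigma^+$ a query string, and let $A$ be the set of all node MEMs between $Q$ and $G$. Then for every MEM $([x..y],(i,P,j))$ between $G$ and $Q$ there is a perfect chain $A'[1..p]\subseteq A$ such that $A'[1]\cdot A'[2]\cdots A'[p]=([x..y],(i,P,j))$.
   Context: Strings are over a finite alphabet $\Sigma$; $T[x..y]$ denotes a substring (empty if $y<x$). A labeled DAG is $G=(V,E,\ell)$ with $\ell:V\to\Sigma^+$; for a node $v$, $\lVert v\rVert=|\ell(v)|$. A path $P=v_1\ldots v_k$ has $(v_t,v_{t+1})\in E$. A substring of $G$ is a triple $(i,P,j)$ with $P=v_1\ldots v_k$ a path, $1\le i\le\lVert v_1\rVert$, $1\le j\le \lVert v_k\rVert$, spelling $\ell(v_1)[i..]\cdot\ell(v_2)\cdots\ell(v_{k-1})\cdot\ell(v_k)[..j]$ (for $k=1$, $\ell(v_1)[i..j]$). A match between $Q$ and $G$ is a pair $([x..y],(i,P,j))$ with $Q[x..y]$ equal to the string spelled by $(i,P,j)$. The left-extension $\mathrm{leftext}(i,P,j)$ is $\{\ell(v_1)[i-1]\}$ if $i>1$ and $\{\ell(u)[\lVert u\rVert] : (u,v_1)\in E\}$ otherwise; the right-extension $\mathrm{rightext}(i,P,j)$ is $\{\ell(v_k)[j+1]\}$ if $j<\lVert v_k\rVert$ and $\{\ell(w)[1] : (v_k,w)\in E\}$ otherwise. Let LeftMax be the condition: $x=1$ or $\mathrm{leftext}(i,P,j)=\emptyset$ or $Q[x-1]\notin\mathrm{leftext}(i,P,j)$;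 RightMax: $y=|Q|$ or $\mathrm{rightext}(i,P,j)=\emptyset$ or $Q[y+1]\notin\mathrm{rightext}(i,P,j)$. A match is a MEM between $Q$ and $G$ if (LeftMax or $|\mathrm{leftext}(i,P,j)|\ge 2$) and (RightMax or $|\mathrm{rightext}(i,P,j)|\ge 2$). A node MEM is a match $([x..y],(i,v,j))$ whose path is a single node $v$ and which satisfies (LeftMax or $i=1$) and (RightMax or $j=\lVert v\rVert$). Two graph substrings $(i,P=u_1\ldots u_k,j)$ and $(i',P'=v_1\ldots v_{k'},j')$ can be concatenated if either $(u_k,v_1)\in E$, $j=\lVert u_k\rVert$, $i'=1$, in which case $(i,P,j)\cdot(i',P',j')=(i,PP',j')$; or $u_k=v_1$ and $i'=j+1$, in which case $(i,P,j)\cdot(i',P',j')=(i,u_1\ldots u_{k-1}v_1\ldots v_{k'},j')$. Two matches $([x..y],(i,P,j))$ and $([x'..y'],(i',P',j'))$ can be concatenated if their graph substrings can and $x'=y+1$, and then their concatenation is $([x..y'],(i,P,j)\cdot(i',P',j'))$. A perfect chain is a sequence $A'[1..p]$ of elements of $A$ such that $A'[t]$ can be concatenated to $A'[t+1]$ for all $1\le t<p$. *)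

(* Defs.v *)
From mathcomp Require Import all_boot.

Set Implicit Arguments.
Unset Strict Implicit.
Unset Printing Implicit Defensive.

(** All string positions are 1-based. *)

Section Strings.
Variable Sigma : finType.

(* [None] outside of the positions 1, ..., size T. *)
Definition char_at (T : seq Sigma) (i : nat) : option Sigma :=
  if i is k.+1 then onth T k else None.

(* For x >= 1; empty if y < x. *)
Definition substr (T : seq Sigma) (x y : nat) : seq Sigma :=
  drop x.-1 (take y T).

End Strings.

Record labeled_dag (Sigma : finType) := LabeledDag {
  node : finType;
  edge : rel node;
  label : node -> seq Sigma;
  label_nonempty : forall v, label v != [::];
  edge_acyclic : forall v p, path edge v p -> last v p = v -> p = [::]
}.

Section Matches.
Variables (Sigma : finType) (G : labeled_dag Sigma).

Definition len (v : node G) : nat := size (label v).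

(* The triple (i, P, j), where the nonempty node sequence P = v_1 ... v_k is
   given by its head v_1 and its tail v_2 ... v_k. That P is a path and the
   bounds on i and j are required by [is_substring]. *)
Record triple := Triple {
  t_start : nat;
  t_head : node G;
  t_tail : seq (node G);
  t_end : nat
}.

Definition t_last (s : triple) : node G := last (t_head s) (t_tail s).

Definition is_substring (s : triple) : bool :=
  [&& path (@edge Sigma G) (t_head s) (t_tail s),
      1 <= t_start s <= len (t_head s) & 1 <= t_end s <= len (t_last s)].

(* In the second case [belast v2 r] is v_2 ... v_{k-1}. *)
Definition spell (s : triple) : seq Sigma :=
  let: Triple i v1 p j := s in
  if p is v2 :: r then
    substr (label v1) i (len v1)
      ++ flatten [seq label v | v <- belast v2 r]
      ++ substr (label (last v2 r)) 1 j
  else substr (label v1) i j.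

Definition leftext (s : triple) : {set Sigma} :=
  if 1 < t_start s then
    [set c | char_at (label (t_head s)) (t_start s).-1 == Some c]
  else
    [set c | [exists u, edge u (t_head s)
                        && (char_at (label u) (len u) == Some c)]].

Definition rightext (s : triple) : {set Sigma} :=
  if t_end s < len (t_last s) then
    [set c | char_at (label (t_last s)) (t_end s).+1 == Some c]
  else
    [set c | [exists w, edge (t_last s) w
                        && (char_at (label w) 1 == Some c)]].

(* The pair ([x..y], (i, P, j)). *)
Record pairing := Pairing {
  m_x : nat;
  m_y : nat;
  m_sub : triple
}.

Variable Q : seq Sigma.

(* Empty matches (y < x, spelling the empty string) are not excluded; the bounds
   on x and y make Q[x-1] meaningful if x <> 1, and Q[y+1] if y <> |Q|. *)
Definition is_match (m : pairing) : bool :=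
  [&& 1 <= m_x m <= (size Q).+1, m_y m <= size Q, is_substring (m_sub m)
    & substr Q (m_x m) (m_y m) == spell (m_sub m)].

Definition left_max (m : pairing) : bool :=
  [|| m_x m == 1, leftext (m_sub m) == set0
    | char_at Q (m_x m).-1 \notin [set Some c | c in leftext (m_sub m)]].

Definition right_max (m : pairing) : bool :=
  [|| m_y m == size Q, rightext (m_sub m) == set0
    | char_at Q (m_y m).+1 \notin [set Some c | c in rightext (m_sub m)]].

Definition is_MEM (m : pairing) : bool :=
  [&& is_match m,
      left_max m || (2 <= #|leftext (m_sub m)|)
    & right_max m || (2 <= #|rightext (m_sub m)|)].

Definition is_node_MEM (m : pairing) : bool :=
  [&& is_match m, nilp (t_tail (m_sub m)),
      left_max m || (t_start (m_sub m) == 1)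
    & right_max m || (t_end (m_sub m) == len (t_last (m_sub m)))].

End Matches.

Section Chains.
Variables (Sigma : finType) (G : labeled_dag Sigma).

(* [None] if the two triples cannot be concatenated. The two cases are mutually
   exclusive when t_end s >= 1. *)
Definition triple_concat (s s' : triple G) : option (triple G) :=
  let: Triple i u us j := s in
  let: Triple i' v vs j' := s' in
  if [&& edge (last u us) v, j == len (last u us) & i' == 1] then
    Some (Triple i u (us ++ v :: vs) j')
  else if (last u us == v) && (i' == j.+1) then
    Some (Triple i u (us ++ vs) j')
  else None.

Definition pairing_concat (m m' : pairing G) : option (pairing G) :=
  if m_x m' == (m_y m).+1 then
    omap (Pairing (m_x m) (m_y m')) (triple_concat (m_sub m) (m_sub m'))
  else None.

Definition can_concat : rel (pairing G) :=
  fun m m' => isSome (pairing_concat m m').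

Definition perfect_chain (A : pred (pairing G)) (c : seq (pairing G)) : bool :=
  all A c && sorted can_concat c.

(* The left-associated product of a chain; [None] for the empty chain. *)
Definition chain_concat (c : seq (pairing G)) : option (pairing G) :=
  if c is m :: c' then
    foldl (fun acc m' => obind (fun a => pairing_concat a m') acc) (Some m) c'
  else None.

End Chains.

(* Main.v *)
(** A MEM is cut at the node boundaries of its path. Every cut lies at the end
    of one label and the start of the next, where node maximality is automatic,
    so only the outer ends of the first and last pieces matter. There a MEM that
    is not maximal has at least two extensions, which is impossible strictly
    inside a label. *)
Require Import Defs.
From mathcomp Require Import all_boot zify.

Set Implicit Arguments.
Unset Strict Implicit.
Unset Printing Implicit Defensive.

Lemma substr_full (Sigma : finType) (T : seq Sigma) : substr T 1 (size T) = T.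
Proof. by rewrite /substr /= take_size drop0. Qed.

Lemma size_substr (Sigma : finType) (T : seq Sigma) x y :
  y <= size T -> size (substr T x y) = y - x.-1.
Proof. by move=> yT; rewrite /substr size_drop size_takel. Qed.

(** The lengths force the cut. Ends are inclusive, so [a] stops at [x + (size a).-1], which is right
    only for nonempty [a]. *)
Lemma substr_cat (Sigma : finType) (T a b : seq Sigma) x y :
  1 <= x -> a != [::] -> substr T x y = a ++ b ->
  substr T x (x + (size a).-1) = a /\ substr T (x + (size a).-1).+1 y = b.
Proof.
rewrite /substr; case: x => // x _; case: a => //= c a _ E.
(* [x] is now the predecessor of the original position. The bound ensures that truncating [T] at [y]
   loses nothing of [a]. *)
have Hy : x + (size a).+1 <= y.
  have := congr1 size E; rewrite size_drop size_take /= size_cat.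
  by case: ifP => ? ?; lia.
split; last first.
  have := congr1 (drop (size a).+1) E.
  by rewrite drop_drop /= drop_size_cat // addnC addnS.
have := congr1 (take (size a).+1) E.
rewrite take_drop take_takel /=; last by lia.
by rewrite take_size_cat // addnC addnS addSn.
Qed.

Section NodeChain.
Variables (Sigma : finType) (G : labeled_dag Sigma).
Implicit Types (u v w : node G) (p r : seq (node G)).

Lemma len_gt0 v : 0 < len v.
Proof. by rewrite /len lt0n size_eq0 label_nonempty. Qed.

(** Gives [spell] a uniform recursion: a whole label is its own substring from 1, so an inner node
    can become the first node of the remaining path. *)
Lemma spell_cons i v w r j :
  spell (Triple i v (w :: r) j) =
  substr (label v) i (len v) ++ spell (Triple 1 w r j).
Proof.
by case: r => [|w' r] //=; rewrite /len substr_full -catA.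
Qed.

Lemma card_leftext_le1 (s : triple G) : 1 < t_start s -> #|leftext s| <= 1.
Proof.
rewrite /leftext => ->; apply/card_le1_eqP => c d.
by rewrite !inE => /eqP-> /eqP[].
Qed.

Lemma card_rightext_le1 (s : triple G) :
  t_end s < len (t_last s) -> #|rightext s| <= 1.
Proof.
rewrite /rightext => ->; apply/card_le1_eqP => c d.
by rewrite !inE => /eqP-> /eqP[].
Qed.

(** The suffix of [label v] from [i] has [len v - i + 1] letters, so its last letter is matched at
    [x + (len v - i)]. *)
Fixpoint node_chain x y i v p j : seq (pairing G) :=
  if p is w :: r then
    Pairing x (x + (len v - i)) (Triple i v [::] (len v))
      :: node_chain (x + (len v - i)).+1 y 1 w r j
  else [:: Pairing x y (Triple i v [::] j)].

Lemma pairing_concat_edge x y i u us y' v j :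
  edge (last u us) v ->
  pairing_concat (Pairing x y (Triple i u us (len (last u us))))
                 (Pairing y.+1 y' (Triple 1 v [::] j))
  = Some (Pairing x y' (Triple i u (us ++ [:: v]) j)).
Proof. by rewrite /pairing_concat /= !eqxx /= => ->. Qed.

Lemma path_node_chain x y0 i u us y w r j :
  edge (last u us) w -> path (@edge Sigma G) w r ->
  path (@can_concat Sigma G) (Pairing x y0 (Triple i u us (len (last u us))))
       (node_chain y0.+1 y 1 w r j).
Proof.
elim: r x y0 i u us w => [|w' r IH] x y0 i u us w e /=.
  by rewrite /can_concat pairing_concat_edge.
case/andP=> e' pr; rewrite /can_concat pairing_concat_edge //=.
exact: (IH _ _ _ w [::]).
Qed.

(** The product associates to the left, so the induction runs over an arbitrary merged prefix [us],
    which grows by one node per step. *)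
Lemma foldl_node_chain x y0 i u us y w r j :
  edge (last u us) w -> path (@edge Sigma G) w r ->
  foldl (fun acc m' => obind (fun a => pairing_concat a m') acc)
        (Some (Pairing x y0 (Triple i u us (len (last u us)))))
        (node_chain y0.+1 y 1 w r j)
  = Some (Pairing x y (Triple i u (us ++ w :: r) j)).
Proof.
elim: r y0 us w => [|w' r IH] y0 us w e.
  by move=> _ /=; rewrite pairing_concat_edge.
case/andP=> e' pr; rewrite [node_chain _ _ _ _ _ _]/= [LHS]/=.
rewrite pairing_concat_edge //.
have := IH (y0.+1 + (len w - 1)) (us ++ [:: w]) w'.
by rewrite last_cat -catA; apply.
Qed.

Variable Q : seq Sigma.

Lemma is_match_cons x y i v w r j :
  is_match Q (Pairing x y (Triple i v (w :: r) j)) ->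
  is_match Q (Pairing x (x + (len v - i)) (Triple i v [::] (len v))) /\
  is_match Q (Pairing (x + (len v - i)).+1 y (Triple 1 w r j)).
Proof.
rewrite /is_match /is_substring /t_last [m_x _]/= [m_y _]/= [m_sub _]/=.
rewrite spell_cons /= => /and4P[/andP[x1 xQ] yQ /and3P[/andP[_ pr] iv jl] /eqP E].
have sa : size (substr (label v) i (len v)) = (len v - i).+1.
  by rewrite size_substr // /len in iv *; lia.
have a0 : substr (label v) i (len v) != [::] by rewrite -size_eq0 sa.
have Hy : x + (len v - i) <= y.
  (* The first piece is nonempty, so the truncated difference [y - x.-1] is a genuine one. *)
  by have := congr1 size E; rewrite size_substr // size_cat sa; lia.
have [] := substr_cat x1 a0 E; rewrite sa /= => Ea Eb.
have lv := len_gt0 v; have lw := len_gt0 w.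
rewrite Ea Eb !eqxx pr iv jl x1 xQ yQ !andbT lv lw leqnn /=.
by rewrite ltnS !(leq_trans Hy yQ).
Qed.

(** The disjunctions are those of a node MEM and survive the induction: the remaining match starts
    at label position 1 and keeps the right end. *)
Lemma all_node_chain x y i v p j (m := Pairing x y (Triple i v p j)) :
  is_match Q m -> left_max Q m || (i == 1) ->
  right_max Q m || (j == len (last v p)) ->
  all (is_node_MEM Q) (node_chain x y i v p j).
Proof.
rewrite {}/m; elim: p x i v => [|w r IH] x i v mm lm rm.
  by rewrite /= andbT; apply/and4P; split.
have [m1 m2] := is_match_cons mm.
rewrite /= IH ?orbT // andbT.
by apply/and4P; split; rewrite //= eqxx orbT.
Qed.

End NodeChain.

Theorem theorem1 (Sigma : finType) (G : labeled_dag Sigma) (Q : seq Sigma)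
    (Q_nonempty : Q != [::]) (m : pairing G) (m_MEM : is_MEM Q m) :
  exists c : seq (pairing G),
    perfect_chain (is_node_MEM Q) c /\ chain_concat c = Some m.
Proof.
case: m m_MEM => x y [i v p j] /and3P[mm lm rm].
exists (node_chain x y i v p j).
have /and4P[_ _ /and3P[/= pp /andP[i1 _] /andP[_ jl]] _] := mm.
have lm' : left_max Q (Pairing x y (Triple i v p j)) || (i == 1).
  case/orP: lm => [-> //|l2]; apply/orP; right.
  rewrite eqn_leq i1 andbT leqNgt; apply/negP => i2.
  by have := leq_trans l2 (card_leftext_le1 (s := Triple i v p j) i2).
have rm' : right_max Q (Pairing x y (Triple i v p j)) || (j == len (last v p)).
  case/orP: rm => [-> //|r2]; apply/orP; right.
  rewrite eqn_leq jl leqNgt; apply/negP => j2.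
  by have := leq_trans r2 (card_rightext_le1 (s := Triple i v p j) j2).
rewrite /perfect_chain all_node_chain //=.
case: p pp {mm lm rm lm' rm' jl} => [|w r] //= /andP[e pr]; split.
  exact: (@path_node_chain _ _ _ _ _ v [::]).
exact: (@foldl_node_chain _ _ _ _ _ v [::]).
Qed.
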